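(* For every (possibly infinite) graph $G$, $\operatorname{odw}(G)\le \operatorname{idw}(G)\le 2\operatorname{odw}(G)$.
   Context: Graphs may be infinite. A tree-decomposition of $G$ is a pair $(T,(B_t:t\in V(T)))$ where $T$ is a (possibly infinite) tree and $B_t\subseteq V(G)$ for each $t$, such that $V(G)=\bigcup_t B_t$; for every edge $uv$ of $G$ some $B_t$ contains both $u,v$; and whenever $t_2$ lies on the path of $T$ between $t_1,t_3$, $B_{t_1}\cap B_{t_3}\subseteq B_{t_2}$. $d_G(u,v)$ is the number of edges of a shortest $u$–$v$ path in $G$ ($\infty$ if none). The inner diameter of a tree-decomposition is the supremum over $t$ of the diameter of the induced subgraph $G[B_t]$ (so $\infty$ if some $G[B_t]$ is disconnected or has unbounded diameter); $\operatorname{idw}(G)$ is the minimum inner diameter over all tree-decompositions of $G$. The outer diameter of a tree-decomposition is $\sup_{t}\max_{u,v\in B_t} d_G(u,v)$ (possibly $\infty$); $\operatorname{odw}(G)$ is the minimum outer diameter over all tree-decompositions of $G$. *)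

(* Defs.v *)
From HB Require Import structures.
From mathcomp Require Import all_boot all_order all_algebra.
From mathcomp Require Import boolp classical_sets reals ereal.

Set Implicit Arguments.
Unset Strict Implicit.
Unset Printing Implicit Defensive.

Local Open Scope classical_set_scope.
Local Open Scope ring_scope.
Local Open Scope ereal_scope.

(* Simple undirected graphs, finite or infinite, possibly with no vertex.
   Asking for an eqType with a boolean adjacency is no restriction: classically
   every type is an eqType and every relation is boolean. *)
Record graph := Graph {
  vertex :> eqType;
  adj : rel vertex;
  adj_sym : symmetric adj;
  adj_irrefl : irreflexive adj }.

(* x :: p lists the vertices in order, so [size p] is the number of edges. *)
Definition is_path (G : graph) (x y : G) (p : seq G) : Prop :=
  [/\ path (@adj G) x p, last x p = y & uniq (x :: p)].

(* The infimum of the empty set is +oo, the distance between vertices that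
   no path joins. *)
Definition dist (R : realType) (G : graph) (u v : G) : \bar R :=
  ereal_inf [set (size p)%:R%:E | p in [set p | is_path u v p]].

Section Induced.
Variables (G : graph) (B : set G).

Let induced_adj : rel {x : G | x \in B} := fun x y => adj (val x) (val y).

Fact induced_sym : symmetric induced_adj.
Proof. by move=> x y; exact: adj_sym. Qed.

Fact induced_irrefl : irreflexive induced_adj.
Proof. by move=> x; exact: adj_irrefl. Qed.

Definition induced : graph := Graph induced_sym induced_irrefl.
End Induced.

Definition connected_graph (G : graph) : Prop :=
  inhabited G /\ forall x y : G, exists p, is_path x y p.

(* [ucycle] also counts the empty cycle and an edge traversed back and forth;
   genuine cycles of a simple graph are those with at least 3 vertices. *)
Definition acyclic (G : graph) : Prop :=
  forall c : seq G, ucycle (@adj G) c -> (size c < 3)%N.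

Definition is_tree (T : graph) : Prop := connected_graph T /\ acyclic T.

Definition is_tree_decomposition (G T : graph) (B : T -> set G) : Prop :=
  [/\ is_tree T,
      forall v : G, exists t, B t v,
      forall u v : G, adj u v -> exists t, B t u /\ B t v
    & forall (t1 t2 t3 : T) (p : seq T),
        is_path t1 t3 p -> t2 \in t1 :: p -> B t1 `&` B t3 `<=` B t2].

(* Suprema of distances are taken in [0, +oo]: as ereal_sup set0 = -oo, the
   maximum with 0 gives empty bags diameter 0. *)
Definition sup0 (R : realType) (A : set (\bar R)) : \bar R :=
  maxe 0 (ereal_sup A).

Definition diameter (R : realType) (G : graph) : \bar R :=
  sup0 [set d | exists u v : G, d = dist R u v].

Definition inner_diameter (R : realType) (G T : graph) (B : T -> set G) :
  \bar R := sup0 [set diameter R (induced (B t)) | t in [set: T]].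

(* Distances are those of the whole graph G, not of the bag. *)
Definition outer_diameter (R : realType) (G T : graph) (B : T -> set G) :
  \bar R :=
  sup0 [set d | exists t u v, [/\ B t u, B t v & d = dist R u v]].

(* Inner and outer diameters lie in {0, 1, 2, ...} U {+oo} and every graph has
   a tree-decomposition (with a single bag), so the infima below are minima. *)
Definition idw (R : realType) (G : graph) : \bar R :=
  ereal_inf [set d | exists (T : graph) (B : T -> set G),
    is_tree_decomposition B /\ d = inner_diameter R B].

Definition odw (R : realType) (G : graph) : \bar R :=
  ereal_inf [set d | exists (T : graph) (B : T -> set G),
    is_tree_decomposition B /\ d = outer_diameter R B].

(* Main.v *)
(** Given a tree-decomposition (B_t), let B'_t be the union of all geodesics
    of G between two vertices of B_t.  If w lies on a geodesic from u to v in
    B_t, if w is in B_s, and t' separates t from s in T, then both halves of the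
    geodesic cross B_t', and the segment between these crossings is a geodesic
    through w; hence w is in B'_t', and (B'_t) is again a tree-decomposition.
    If the outer diameter of (B_t) is k, each vertex of B'_t is joined inside
    B'_t to B_t by a path of length at most k/2, and any two vertices of B_t by
    one of length at most k, so (B'_t) has inner diameter at most 2k. *)
Require Import Defs.
From mathcomp Require Import all_boot all_order all_algebra.
From mathcomp Require Import boolp classical_sets reals ereal.
From mathcomp Require Import lra.

Import Order.TTheory GRing.Theory Num.Theory.

Local Open Scope ring_scope.
Local Open Scope ereal_scope.

(** * Walks, geodesics and separation by a vertex *)

Definition is_walk {G : graph} (x y : G) (p : seq G) : Prop :=
  path (@adj G) x p /\ last x p = y.

Definition is_geodesic {G : graph} (x y : G) (p : seq G) : Prop :=
  is_walk x y p /\ forall q, is_walk x y q -> (size p <= size q)%N.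

(** Its negation says that [t] separates [a] from [b]; an end equal to [t] counts as separated.
    Walks, which may repeat vertices, make transitivity plain concatenation. *)
Definition joined_avoiding {G : graph} (t a b : G) : Prop :=
  exists2 p, is_walk a b p & t \notin a :: p.

Definition geodesic_hull {G : graph} (B : set G) : set G :=
  fun w => exists u v p, [/\ B u, B v, is_geodesic u v p & w \in u :: p].

Section Walks.
Context {G : graph}.
Implicit Types (x y z t : G) (p q : seq G).

Lemma is_walk_cat {x y z p q} :
  is_walk x y p -> is_walk y z q -> is_walk x z (p ++ q).
Proof. by move=> [pp <-] [pq <-]; split; rewrite ?cat_path ?pp ?last_cat. Qed.

Lemma is_walk_catE x z p q :
  is_walk x z (p ++ q) -> is_walk x (last x p) p /\ is_walk (last x p) z q.
Proof. by move=> []; rewrite cat_path last_cat => /andP[]. Qed.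

Lemma is_walk_rev {x y p} :
  is_walk x y p ->
  exists q, [/\ is_walk y x q, size q = size p & y :: q =i x :: p].
Proof.
move=> [pp <-]; exists (rev (belast x p)); split.
- split.
    by rewrite rev_path (eq_path (e' := @adj G)) // => a b; rewrite adj_sym.
  by case: p {pp} => //= a p; rewrite rev_cons last_rcons.
- by rewrite size_rev size_belast.
- by move=> z; rewrite (lastI x p) -(mem_rev (rcons _ _)) rev_rcons.
Qed.

Lemma is_walk_shorten {x y p} :
  is_walk x y p ->
  exists q, [/\ is_path x y q, (size q <= size p)%N & {subset q <= p}].
Proof.
move=> [pp <-]; case/shortenP: (pp) => q pq uq sq; exists q; split=> //.
by apply: uniq_leq_size sq; case/andP: uq.
Qed.

Lemma joined_avoiding_sym t a b :
  joined_avoiding t a b -> joined_avoiding t b a.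
Proof.
by move=> [p wp tp]; have [q [wq _ eq]] := is_walk_rev wp; exists q; rewrite ?eq.
Qed.

Lemma joined_avoiding_trans t a b c :
  joined_avoiding t a b -> joined_avoiding t b c -> joined_avoiding t a c.
Proof.
move=> [p wp tp] [q wq tq]; exists (p ++ q); first exact: is_walk_cat wp wq.
by move: tp tq; rewrite -cat_cons mem_cat !inE !negb_or => -> /andP[].
Qed.

Lemma exists_geodesic x y p : is_walk x y p -> exists q, is_geodesic x y q.
Proof.
move=> wp; pose P n := `[< exists2 q, is_walk x y q & size q = n >].
have exP : exists n, P n by exists (size p); apply/asboolP; exists p.
case: (ex_minnP exP) => n /asboolP[q wq <-] min; exists q; split=> // r wr.
by apply: min; apply/asboolP; exists r.
Qed.

(** A shorter walk in place of [q] would shorten the whole geodesic. *)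
Lemma is_geodesic_infix x y p q r :
  is_geodesic x y (p ++ q ++ r) ->
  is_geodesic (last x p) (last (last x p) q) q.
Proof.
move=> [wp min]; have [w1 /is_walk_catE[w2 w3]] := is_walk_catE _ _ _ _ wp.
split=> // s ws; have := min _ (is_walk_cat w1 (is_walk_cat ws w3)).
by rewrite !size_cat leq_add2l leq_add2r.
Qed.

(* Two neighbours of [t] on the path joined by a walk avoiding [t] would close
   a cycle through [t]. *)
Lemma acyclic_path_separates a b t p :
  acyclic G -> is_path a b p -> t \in a :: p -> ~ joined_avoiding t a b.
Proof.
move=> acG [pp lp up] tp [q [pq lq] tq].
have [ta tq'] : t != a /\ t \notin q by apply/andP; rewrite -negb_or -in_cons.
have tb : t != b.
  by apply: contraNneq tq => ->; rewrite -lq mem_last.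
move: tp; rewrite inE (negPf ta) /= => tp.
case/splitPr: tp pp lp up => p1 [|y p2].
  by rewrite last_cat /= => _ eb; rewrite eb eqxx in tb.
rewrite -cat_cons cat_uniq cat_path last_cat => /andP[pp1 pp2] lp.
move=> /and3P[up1 /hasPn disj] /=.
move: pp2 lp => /= /and3P[xt ty pp2] lp.
rewrite inE negb_or -!andbA => /and4P[_ tp2 yp2 up2].
have xy : last a p1 != y.
  apply: contraNneq (disj y _) => [<-|]; first exact: mem_last.
  by rewrite !inE eqxx orbT.
have tap1 : t \notin a :: p1 by apply: disj; rewrite inE eqxx.
have nty : t != y by apply: contraTneq ty => ->; rewrite adj_irrefl.
(* Go back along [p1] to [a], along [q] to [b], then back along [p2] to [y]. *)
have joined : joined_avoiding t (last a p1) y.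
  apply: (@joined_avoiding_trans _ _ a).
    by apply: joined_avoiding_sym; exists p1.
  apply: (@joined_avoiding_trans _ _ b); first by exists q.
  by apply: joined_avoiding_sym; exists p2; rewrite // inE negb_or nty.
have [r wr tr] := joined.
have [s [[ps ls us] _ sub]] := is_walk_shorten wr.
(* The neighbours of [t] differ, so [s] is nonempty and the cycle has the three vertices that
   [acyclic] asks for. *)
case: s ls ps us sub => [/= e|z s ls ps us sub]; first by rewrite e eqxx in xy.
suff /acG : ucycle (@adj G) (t :: last a p1 :: z :: s) by [].
apply/andP; split.
  rewrite /= rcons_path -/(path _ _ (z :: s)).
  move: ps ls => /= /andP[-> ->] ->.
  by rewrite adj_sym xt adj_sym ty.
rewrite cons_uniq us andbT.
apply: contra tr; rewrite in_cons => /orP[/eqP->|/sub zr].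
  exact: mem_head.
by rewrite in_cons zr orbT.
Qed.

End Walks.

(** * The geodesic hulls of the bags form a tree-decomposition *)

Section GeodesicHull.
Context {G T : graph} {B : T -> set G}.
Hypothesis decB : is_tree_decomposition B.

(** Every bag on the tree path from [a] to [b] contains [x], so this path misses [s]. *)
Lemma bags_joined_avoiding s a b (x : G) :
  B a x -> B b x -> ~ B s x -> joined_avoiding s a b.
Proof.
have [[[_ conn] _] _ _ inter] := decB => ax bx nsx.
have [p pp] := conn a b; exists p; first by case: pp.
by apply/negP => sp; apply/nsx/(inter _ _ _ _ pp sp).
Qed.

(** Consecutive vertices of the walk share a bag, so tree paths between bags with a common vertex
    outside [B s] can be chained. *)
Lemma walk_joined_avoiding s a b (x : G) p :
  path (@adj G) x p -> B a x -> B b (last x p) ->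
  (forall z, z \in x :: p -> ~ B s z) -> joined_avoiding s a b.
Proof.
have [_ _ edge _] := decB.
elim: p x a => [|y p IH] x a /=.
  by move=> _ ax bx av; apply: bags_joined_avoiding ax bx (av _ (mem_head _ _)).
move=> /andP[xy pp] ax bl av; have [c [cx cy]] := edge _ _ xy.
apply: (@joined_avoiding_trans _ _ _ c).
  exact: bags_joined_avoiding ax cx (av _ (mem_head _ _)).
by apply: (IH y) => // z zp; apply: av; rewrite inE zp orbT.
Qed.

Lemma walk_meets_separating_bag s a b (x : G) p :
  path (@adj G) x p -> B a x -> B b (last x p) -> ~ joined_avoiding s a b ->
  exists2 z, z \in x :: p & B s z.
Proof.
move=> pp ax bl nj; apply: contrapT => nex; apply: nj.
by apply: walk_joined_avoiding pp ax bl _ => z zp sz; apply: nex; exists z.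
Qed.

Lemma geodesic_hull_separating s a b (w : G) :
  geodesic_hull (B a) w -> B b w -> ~ joined_avoiding s a b ->
  geodesic_hull (B s) w.
Proof.
move=> [u [v [p [au av gp wp]]]] bw nj.
case/splitPl: wp gp => p1 p2 lp1 gp.
have [[pp lp] _] := gp.
move: pp lp; rewrite cat_path last_cat lp1 => /andP[pp1 pp2] lp2.
have [u1 u1p su1] : exists2 z, z \in u :: p1 & B s z.
  by apply: walk_meets_separating_bag pp1 au _ nj; rewrite lp1.
(* The second half leads from bag [b] back to bag [a], hence the swapped roles. *)
have [v1 v1p sv1] : exists2 z, z \in w :: p2 & B s z.
  apply: (@walk_meets_separating_bag s b a) pp2 bw _ _; first by rewrite lp2.
  by move/joined_avoiding_sym.
(* Cutting the halves at [u1] and [v1] leaves the middle segment [b1 ++ a2], a geodesic from [u1] to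
   [v1] through [w]. *)
case/splitPl: u1p lp1 gp {pp1} => a1 b1 la1; rewrite last_cat la1 => lb1.
case/splitPl: v1p {pp2 lp2} => a2 b2 la2.
rewrite -catA (catA b1) => /is_geodesic_infix.
rewrite la1 last_cat lb1 la2 => g; exists u1, v1, (b1 ++ a2); split=> //.
by rewrite -cat_cons mem_cat -lb1 mem_last.
Qed.

Lemma sub_geodesic_hull (A : set G) : (A `<=` geodesic_hull A)%classic.
Proof.
by move=> x Ax; exists x, x, [::]; split=> //; rewrite ?mem_head.
Qed.

Lemma geodesic_hull_tree_decomposition :
  is_tree_decomposition (fun t => geodesic_hull (B t)).
Proof.
have [treeT cover edge inter] := decB; split=> //.
- by move=> v; have [t tv] := cover v; exists t; exact: sub_geodesic_hull.
- move=> u v /edge[t [tu tv]]; exists t.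
  by split; exact: sub_geodesic_hull.
- move=> t1 t2 t3 p pp t2p w [w1 w3]; have [s sw] := cover w.
  have nj := acyclic_path_separates _ _ _ _ treeT.2 pp t2p.
  (* As [t2] separates [t1] from [t3], it separates the node [s], whose original bag contains [w],
     from at least one of them. *)
  have [j1|] := pselect (joined_avoiding t2 t1 s); last first.
    exact: geodesic_hull_separating w1 sw.
  apply: geodesic_hull_separating w3 sw _ => j3; apply: nj.
  exact: joined_avoiding_trans j1 (joined_avoiding_sym _ _ _ j3).
Qed.

End GeodesicHull.

(** * Distances, diameters and the bound on the inner diameter of the hulls *)

Section Distance.
Context {R : realType}.
Implicit Types G T : graph.

Lemma sup0_ge0 (A : set (\bar R)) : 0 <= Defs.sup0 A.
Proof. by rewrite /Defs.sup0 le_max lexx. Qed.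

Lemma sup0_le (A : set (\bar R)) d :
  0 <= d -> (forall x, A x -> x <= d) -> Defs.sup0 A <= d.
Proof. by move=> d0 Ad; rewrite /Defs.sup0 ge_max d0; apply: ge_ereal_sup. Qed.

Lemma le_sup0 (A : set (\bar R)) x : A x -> x <= Defs.sup0 A.
Proof. by move=> Ax; rewrite /Defs.sup0 le_max ereal_sup_ubound ?orbT. Qed.

Lemma dist_le_walk G (u v : G) p : is_walk u v p -> dist R u v <= (size p)%:R%:E.
Proof.
move=> /is_walk_shorten[q [pq qp _]].
apply: (@le_trans _ _ (size q)%:R%:E); last by rewrite lee_fin ler_nat.
by apply: ereal_inf_lbound; exists q.
Qed.

Lemma dist_geodesic_ge G (u v : G) p :
  is_geodesic u v p -> (size p)%:R%:E <= dist R u v.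
Proof.
move=> [_ min]; apply: le_ereal_inf_tmp => _ [q [pq lq _] <-].
by rewrite lee_fin ler_nat; apply: min.
Qed.

Lemma dist_lty_walk G (u v : G) : dist R u v < +oo -> exists p, is_walk u v p.
Proof.
move=> duv; apply: contrapT => nex; move: duv.
rewrite ltNge => /negP; apply; apply: le_ereal_inf_tmp => _ [q [pq lq _] <-].
by case: nex; exists q.
Qed.

Lemma dist_induced_ge G (B : set G) (x y : induced B) :
  dist R (val x) (val y) <= dist R x y.
Proof.
apply: le_ereal_inf_tmp => _ [p [pp lp _] <-] /=; rewrite -(size_map val p).
by apply: dist_le_walk; split; rewrite ?last_map ?lp // path_map.
Qed.

Lemma induced_lift_walk G (B : set G) (x y : induced B) p :
  is_walk (val x) (val y) p -> (forall z, z \in p -> B z) ->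
  exists2 q, is_walk x y q & size q = size p.
Proof.
elim: p x => [|z p IH] x.
  by move=> [_ /= e] _; exists [::] => //; split=> //; apply: val_inj.
move=> [/= /andP[xz pp] lp] Bp.
have zB : z \in B by rewrite inE; apply: Bp; rewrite mem_head.
have [|q [pq lq] sq] := IH (exist _ z zB) (conj pp lp).
  by move=> a ap; apply: Bp; rewrite inE ap orbT.
by exists (exist _ z zB :: q); [split=> //=; rewrite pq andbT | rewrite /= sq].
Qed.

Lemma outer_le_inner G T (B : T -> set G) :
  outer_diameter R B <= inner_diameter R B.
Proof.
apply: sup0_le; first exact: sup0_ge0.
move=> _ [t [u [v [tu tv ->]]]].
have uB : u \in B t by rewrite inE.
have vB : v \in B t by rewrite inE.
apply: (@le_trans _ _ (diameter R (induced (B t)))); last first.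
  by apply: le_sup0; exists t.
apply: le_trans (dist_induced_ge _ _ (exist _ u uB) (exist _ v vB)) _.
by apply: le_sup0; exists (exist _ u uB), (exist _ v vB).
Qed.

(* [u] is the nearer end of the geodesic through [w], whence the factor 1/2. *)
Lemma geodesic_hull_near G (A : set G) (k : R) (w : G) :
  (forall u v p, A u -> A v -> is_geodesic u v p -> ((size p)%:R <= k)%R) ->
  geodesic_hull A w ->
  exists u p, [/\ A u, is_walk w u p, ((size p)%:R <= k / 2)%R
                & forall z, z \in p -> geodesic_hull A z].
Proof.
move=> Ak [u [v [p [Au Av gp wp]]]]; have sk := Ak _ _ _ Au Av gp.
have hull z : z \in u :: p -> geodesic_hull A z by exists u, v, p.
have [[pp lp] _] := gp.
case/splitPl: wp hull pp lp sk {gp} => p1 p2 lp1 hull.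
rewrite cat_path last_cat lp1 size_cat natrD => /andP[pp1 pp2] lp2 sk.
have [le12|lt21] := leqP (size p1) (size p2).
  have [q [wq sq eq]] := is_walk_rev (conj pp1 lp1).
  exists u, q; split=> //.
    by move: le12; rewrite sq -(ler_nat R); lra.
  move=> z zq; apply: hull; rewrite -cat_cons mem_cat -eq.
  by rewrite inE zq orbT.
exists v, p2; split=> //.
  by move: lt21 => /ltnW; rewrite -(ler_nat R); lra.
by move=> z zq; apply: hull; rewrite inE mem_cat zq !orbT.
Qed.

Lemma inner_geodesic_hull_le G T (B : T -> set G) :
  inner_diameter R (fun t => geodesic_hull (B t)) <= 2%:E * outer_diameter R B.
Proof.
have D0 : 0 <= outer_diameter R B by exact: sup0_ge0.
have distD t u v : B t u -> B t v -> dist R u v <= outer_diameter R B.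
  by move=> tu tv; apply: le_sup0; exists t, u, v.
(* Nonnegativity excludes [-oo], and for [+oo] the right-hand side is infinite; a real [k]
   remains. *)
case: (outer_diameter R B) D0 distD => [k||] // k0 distk; last first.
  by rewrite gt0_muley ?leey // lte_fin.
have {}k0 : (0 <= k)%R by rewrite -lee_fin.
have dk0 : 0 <= 2%:E * k%:E by rewrite -EFinM lee_fin mulr_ge0.
have geok t u v p : B t u -> B t v -> is_geodesic u v p -> ((size p)%:R <= k)%R.
  move=> tu tv gp; rewrite -lee_fin.
  exact: le_trans (dist_geodesic_ge _ _ _ _ gp) (distk _ _ _ tu tv).
apply: sup0_le => // _ [t _ <-]; apply: sup0_le => // _ [x [y ->]].
have [u [p [tu wp sp hp]]] : exists u p,
    [/\ B t u, is_walk (val x) u p, ((size p)%:R <= k / 2)%R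
      & forall z, z \in p -> geodesic_hull (B t) z].
  by apply: geodesic_hull_near; [exact: geok | rewrite -inE; exact: (valP x)].
have [v [q [tv wq sq hq]]] : exists u p,
    [/\ B t u, is_walk (val y) u p, ((size p)%:R <= k / 2)%R
      & forall z, z \in p -> geodesic_hull (B t) z].
  by apply: geodesic_hull_near; [exact: geok | rewrite -inE; exact: (valP y)].
have [q' [wq' sq' eq']] := is_walk_rev wq.
(* A finite outer diameter forces [u] and [v] into the same component of [G]. *)
have [r0 wr0] : exists r, is_walk u v r.
  by apply: dist_lty_walk; apply: le_lt_trans (distk _ _ _ tu tv) (ltry _).
have [r gr] := exists_geodesic _ _ _ wr0.
have hull_r z : z \in u :: r -> geodesic_hull (B t) z by exists u, v, r.
(* The walk from [x] to [u], on to [v] and then to [y] stays in the hull and has length at most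
   [k / 2 + k + k / 2]. *)
have [||s ws ss] := induced_lift_walk _ _ x y (p ++ (r ++ q')).
- exact: is_walk_cat wp (is_walk_cat gr.1 wq').
- move=> z; rewrite !mem_cat => /or3P[/hp //|zr|zq'].
    by apply: hull_r; rewrite inE zr orbT.
  have : z \in v :: q' by rewrite inE zq' orbT.
  rewrite eq' inE => /orP[/eqP ->|/hq //].
  by rewrite -inE; exact: (valP y).
apply: le_trans (dist_le_walk _ _ _ _ ws) _.
rewrite -EFinM lee_fin ss !size_cat sq' !natrD.
by move: (geok _ _ _ _ tu tv gr); lra.
Qed.

End Distance.

Theorem theorem1p4 (R : realType) (G : graph) :
  odw R G <= idw R G /\ idw R G <= 2%:E * odw R G.
Proof.
split; first apply: le_ereal_inf_tmp => _ [T [B [decB ->]]].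
  apply: le_trans (outer_le_inner G T B).
  by apply: ereal_inf_lbound; exists T, B.
(* Division by 2 turns the claim into a lower bound on the infimum [odw R G], checked on one
   decomposition at a time. *)
rewrite -lee_pdivrMl //; apply: le_ereal_inf_tmp => _ [T [B [decB ->]]].
rewrite lee_pdivrMl //; apply: le_trans (inner_geodesic_hull_le G T B).
apply: ereal_inf_lbound; exists T, (fun t => geodesic_hull (B t)).
by split=> //; exact: geodesic_hull_tree_decomposition.
Qed.
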